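(* For all positive integers $d$ and $n$, the bin-graph $d$-process $\mathcal B(d,n)$ on $n$ bins has exactly the same distribution as the graph $d$-process $\mathcal P(d,n)$.
   Context: Graph $d$-process $\mathcal P(d,n)$: start with the empty graph on $n$ vertices; at each step add one edge chosen uniformly at random from all pairs of distinct vertices that are not yet edges and both of whose vertices currently have degree less than $d$; stop when no such pair exists. Bin $d$-process on $n$ bins: start with $n$ empty distinguishable bins and drop balls one by one, independently, into bins chosen uniformly at random. During the process some balls are assigned numbers and some are deemed good. A bin is unsaturated if it currently contains fewer than $d$ good balls, and saturated otherwise. Balls falling into unsaturated bins are numbered consecutively $1,2,\dots$; a ball falling into a saturated bin remains unnumbered. A pair is the set of the two balls numbered $i-1$ and $i$, for some even $i\ge2$. A pair, and each ball in it, is good if its two balls fall into distinct bins and no previous pair of balls fell into the same pair of bins; otherwise the pair and both its balls are bad. A numbered ball not yet paired is called the waiting ball; it is neither good nor bad and does not count in determining whether a bin is saturated. The process terminates when no more good pairs can be added. Bin-graph $d$-process: the vertices are the bins, and each good pair determines an edge joining the two bins into which its balls have fallen. $G'_s$ is the graph after $s$ edges have been added, and $\mathcal B(d,n)=(G'_0,G'_1,\dots)$. *)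

(* Defs.v *)
From mathcomp Require Import all_boot all_order all_algebra.
From mathcomp Require Import all_classical all_reals all_analysis.

Set Implicit Arguments.
Unset Strict Implicit.
Unset Printing Implicit Defensive.

Import Order.TTheory GRing.Theory Num.Theory.

(* A graph on the vertex set 'I_n is given by its set of edges, an edge being a
   two-element set of vertices. *)
Notation graph n := {set {set 'I_n}}.

Definition empty_graph n : graph n := finset.set0.

Definition degree n (g : graph n) (v : 'I_n) : nat :=
  #|[set e in g | v \in e]%SET|.

Definition available n (d : nat) (g : graph n) : {set {set 'I_n}} :=
  [set e : {set 'I_n} | [&& #|e| == 2, e \notin g &
                            [forall v in e, degree g v < d]]]%SET.

(* The bin of each ball of a pair, the ball with the odd number first. *)
Notation bpair n := ('I_n * 'I_n)%type.

Definition bins_of n (p : bpair n) : {set 'I_n} := [set p.1; p.2]%SET.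

Definition is_good n (previous : seq (bpair n)) (p : bpair n) : bool :=
  (p.1 != p.2) && (bins_of p \notin [seq bins_of q | q <- previous]).

(* [pairs] lists all pairs formed so far, good and bad, the latest one first;
   [waiting] is the bin of the waiting ball, if any.  Unnumbered balls leave no
   trace, since nothing in the process depends on them. *)
Record bin_state (n : nat) := BinState {
  pairs : seq (bpair n);
  waiting : option 'I_n
}.

Fixpoint good_pairs n (ps : seq (bpair n)) : seq (bpair n) :=
  if ps is p :: ps' then
    if is_good ps' p then p :: good_pairs ps' else good_pairs ps'
  else [::].

Definition good_balls n (st : bin_state n) (b : 'I_n) : nat :=
  \sum_(p <- good_pairs (pairs st)) ((p.1 == b) + (p.2 == b)).

Definition unsaturated n (d : nat) (st : bin_state n) (b : 'I_n) : bool :=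
  good_balls st b < d.

Definition drop_ball n (d : nat) (st : bin_state n) (b : 'I_n) : bin_state n :=
  if unsaturated d st b then
    if waiting st is Some a then BinState ((a, b) :: pairs st) None
    else BinState (pairs st) (Some b)
  else st.

Fixpoint bin_process n (d : nat) (balls : nat -> 'I_n) (t : nat) : bin_state n :=
  if t is t'.+1 then drop_ball d (bin_process d balls t') (balls t')
  else BinState [::] None.

(* A waiting ball can be ignored here: it lies in an unsaturated bin, and a
   second ball in that bin completes a bad pair, which changes neither the
   saturated bins nor the pairs that would be good. *)
Definition terminated n (d : nat) (st : bin_state n) : bool :=
  ~~ [exists a, exists b, [&& unsaturated d st a, unsaturated d st b &
                              is_good (pairs st) (a, b)]].

(* The graphs G'_0, G'_1, ... obtained from the good pairs in order of arrival. *)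
Definition bin_graphs n (st : bin_state n) : seq (graph n) :=
  let edges := rev [seq bins_of p | p <- good_pairs (pairs st)] in
  [seq [set e in take s edges]%SET | s <- iota 0 (size edges).+1].

(* The bin-graph d-process driven by an infinite sequence of balls, as the
   finite sequence (G'_0, G'_1, ...) of all graphs up to termination.  The value
   [::], which is never the sequence of graphs of a terminating run, is used if
   the process does not terminate. *)
Definition bin_graph_process n (d : nat) (balls : nat -> 'I_n) : seq (graph n) :=
  match pselect (exists t, terminated d (bin_process d balls t)) with
  | left ex => bin_graphs (bin_process d balls (ex_minn ex))
  | right _ => [::]
  end.

Local Open Scope classical_set_scope.
Local Open Scope ring_scope.
Local Open Scope ereal_scope.

(* Random variables with values in a countable type, carrying the discrete
   sigma-algebra. *)
Definition discrete_RV (disp : measure_display) (T : measurableType disp)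
    (U : countType) (Y : T -> U) : Prop :=
  forall A : set U, measurable (Y @^-1` A).

Definition same_distribution (R : realType)
    (d1 d2 : measure_display) (T1 : measurableType d1) (T2 : measurableType d2)
    (P1 : probability T1 R) (P2 : probability T2 R)
    (U : countType) (Y1 : T1 -> U) (Y2 : T2 -> U) : Prop :=
  [/\ discrete_RV Y1, discrete_RV Y2 &
      forall A : set U, P1 (Y1 @^-1` A) = P2 (Y2 @^-1` A)].

Definition mutually_independent (R : realType)
    (disp : measure_display) (T : measurableType disp) (P : probability T R)
    (U : countType) (X : nat -> T -> U) : Prop :=
  forall (J : seq nat) (A : nat -> set U), uniq J ->
    P (\bigcap_(i in [set` J]) (X i @^-1` A i)) = \prod_(i <- J) P (X i @^-1` A i).

(* [X i w] is the bin into which ball [i] falls. *)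
Definition uniform_balls (R : realType)
    (disp : measure_display) (T : measurableType disp) (P : probability T R)
    (n : nat) (X : nat -> T -> 'I_n) : Prop :=
  [/\ forall i, discrete_RV (X i),
      forall i b, P (X i @^-1` [set b]) = ((n%:R)^-1)%:E &
      mutually_independent P X].

(* [G w] is the finite sequence of graphs produced by a run.  For each possible
   initial segment [rcons h g], conditionally on the run starting with it, the
   run stops if no edge is available, and otherwise goes on by adding an edge
   that is uniformly distributed on the available ones. *)
Definition graph_process (R : realType)
    (disp : measure_display) (T : measurableType disp) (P : probability T R)
    (n d : nat) (G : T -> seq (graph n)) : Prop :=
  [/\ discrete_RV G,
      P [set w | prefix [:: empty_graph n] (G w)] = 1 &
      forall (h : seq (graph n)) (g : graph n),
        let past := [set w | prefix (rcons h g) (G w)] in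
        (available d g = finset.set0 ->
           P [set w | G w = rcons h g] = P past) /\
        (forall e, e \in available d g ->
           P [set w | prefix (rcons (rcons h g) (e |: g)%SET) (G w)] =
           P past * ((#|available d g|%:R)^-1)%:E)].

(* Main.v *)
Require Import Defs.
From mathcomp Require Import all_boot all_order all_algebra.
From mathcomp Require Import all_classical all_reals all_analysis.
From mathcomp Require Import ring lra.

Set Implicit Arguments.
Unset Strict Implicit.
Unset Printing Implicit Defensive.

Import Order.TTheory GRing.Theory Num.Theory.

(** The bin process is observed only through the list of pairs formed so far.
    Its good pairs are the edges of a simple graph in which the degree of a
    vertex is the number of good balls in the bin, so a pair [(a, b)] of balls
    in unsaturated bins is good exactly when the edge [{a, b}] is available.
    A pair of consecutively numbered balls is uniform on the ordered pairs of
    unsaturated bins, and each available edge comes from exactly two of these;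
    hence the next edge is uniform on the available edges
    ([sum_over_pairs]).

    This is turned into an identity of laws by a martingale argument.  Fix a
    sequence [s] of graphs.  Let [completion_prob s] send an initial segment
    of a run to the probability that the graph process, started from it,
    produces exactly [s].  It is harmonic for the graph process
    ([completion_prob_harmonic]); extended to states with a waiting ball by
    averaging over the bin of the next numbered ball, it is harmonic for the
    chain of bin states stopped at termination
    ([iter_mean_completion_prob]).  At a terminated state its value is at
    least the indicator of having produced [s].  So the probability that the
    bin process produces [s] is at most the initial value of
    [completion_prob s] plus the probability of still running after [t] balls.
    The latter is [O(1/t)]: a bounded potential, the number of edges with a
    small penalty for a waiting ball, grows in mean by at least [n ^- 3] at
    each ball until termination ([potential_drift], [running_bound]).

    On the other side, multiplying the transition probabilities of a graph
    process bounds the probability that it produces [s] from below by the same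
    quantity ([graph_process_ge]).  One inequality between the masses of
    single sequences is enough: summed over a set and over its complement, it
    forces the two laws to coincide ([discrete_le_same_distribution]). *)

(** * Good pairs and available edges *)

Definition edges n (ps : seq (bpair n)) : seq {set 'I_n} :=
  [seq bins_of p | p <- good_pairs ps].

Definition graph_of n (ps : seq (bpair n)) : graph n :=
  [set e in edges ps]%SET.

Definition initial_graphs n (es : seq {set 'I_n}) : seq (graph n) :=
  [seq [set e in take s es]%SET | s <- iota 0 (size es).+1].

Definition graphs n (ps : seq (bpair n)) : seq (graph n) :=
  initial_graphs (rev (edges ps)).

Lemma edges_cons n p (ps : seq (bpair n)) :
  edges (p :: ps) = if is_good ps p then bins_of p :: edges ps else edges ps.
Proof. by rewrite /edges /=; case: ifP. Qed.

Lemma card_bins_of n (p : bpair n) : #|bins_of p| = (p.1 != p.2).+1.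
Proof. exact: cards2. Qed.

(** A 2-set spanned by some earlier pair is always spanned by an earlier good
    pair, namely the first pair that spans it; so bad pairs can be forgotten. *)
Lemma mem_edges n (ps : seq (bpair n)) e :
  (e \in edges ps) = (#|e| == 2) && (e \in [seq bins_of q | q <- ps]).
Proof.
elim: ps e => [|p ps IH] e; first by rewrite andbF.
rewrite edges_cons /is_good map_cons [e \in bins_of p :: map _ _]inE.
have [-> | ne] /= := eqVneq e (bins_of p); last first.
  by case: ifP => _; rewrite ?inE ?(negPf ne) /= IH.
rewrite card_bins_of andbT eqSS eqb1; case: (p.1 != p.2) (card_bins_of p) => /= cp.
  by case: ifP => [_|/negbFE h]; [rewrite inE eqxx | rewrite IH cp h].
by rewrite IH cp.
Qed.

Lemma is_goodE n (ps : seq (bpair n)) p :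
  is_good ps p = (p.1 != p.2) && (bins_of p \notin graph_of ps).
Proof.
by rewrite /is_good inE mem_edges card_bins_of; case: (p.1 != p.2).
Qed.

Lemma edges_uniq n (ps : seq (bpair n)) : uniq (edges ps).
Proof.
elim: ps => [//|p ps IH]; rewrite edges_cons is_goodE inE.
by case: ifP => //= /andP[_ ->].
Qed.

Lemma edges_bound n (ps : seq (bpair n)) : size (edges ps) <= #|{set 'I_n}|.
Proof. by rewrite -(card_uniqP (edges_uniq ps)) max_card. Qed.

Lemma graph_of_cons n p (ps : seq (bpair n)) : is_good ps p ->
  graph_of (p :: ps) = (bins_of p |: graph_of ps)%SET.
Proof. by move=> gp; apply/setP => e; rewrite !inE edges_cons gp inE. Qed.

Lemma graph_of_cons_bad n p (ps : seq (bpair n)) : ~~ is_good ps p ->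
  graph_of (p :: ps) = graph_of ps.
Proof. by move=> /negPf bp; rewrite /graph_of edges_cons bp. Qed.

Lemma degree_add n (g : graph n) (e : {set 'I_n}) v : e \notin g ->
  degree (e |: g)%SET v = (v \in e) + degree g v.
Proof.
move=> eg; rewrite /degree; have [ve|ve] := boolP (v \in e).
  rewrite (_ : finset _ = e |: [set f in g | v \in f])%SET.
    by rewrite cardsU1 inE (negPf eg).
  apply/setP => f; rewrite !inE andb_orl; congr (_ || _).
  by case: eqP => // ->; rewrite ve.
congr #|pred_of_set _|; apply/setP => f; rewrite !inE andb_orl.
by case: eqP => // ->; rewrite (negPf ve) andbF.
Qed.

(** Good pairs have two distinct bins and span distinct edges, so that no ball is
    lost or counted twice on passing to the graph. *)
Lemma good_balls_degree n (st : bin_state n) b :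
  good_balls st b = degree (graph_of (pairs st)) b.
Proof.
rewrite /good_balls; elim: (pairs st) => [|p ps IH] /=.
  rewrite big_nil /degree (_ : finset _ = finset.set0) ?cards0 //.
  by apply/setP => e; rewrite !inE.
case: ifPn => [gp|bp]; last by rewrite graph_of_cons_bad.
rewrite big_cons IH graph_of_cons //.
move: gp; rewrite is_goodE => /andP[np eg]; rewrite degree_add // !inE.
by move: np; rewrite [b == p.1]eq_sym [b == p.2]eq_sym;
  case: (p.1 =P b) (p.2 =P b) => [->|?] [->|?] //; rewrite eqxx.
Qed.

(** Saturation and goodness depend on the past only through the graph: this makes
    the sequence of graphs autonomous and ties it to the graph process. *)
Lemma mem_available n d (ps : seq (bpair n)) w a b :
  (bins_of (a, b) \in available d (graph_of ps)) =
  [&& unsaturated d (BinState ps w) a, unsaturated d (BinState ps w) b &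
      is_good ps (a, b)].
Proof.
rewrite inE is_goodE card_bins_of eqSS eqb1 /=.
rewrite /unsaturated !good_balls_degree /=.
rewrite [RHS]andbA [RHS]andbC -[RHS]andbA; congr [&& _, _ & _].
apply/forall_inP/andP => [h|[ha hb] v].
  by split; apply: h; rewrite !inE eqxx ?orbT.
by rewrite !inE => /orP[] /eqP->.
Qed.

Lemma terminatedE n d (st : bin_state n) :
  terminated d st = (available d (graph_of (pairs st)) == finset.set0).
Proof.
case: st => ps w; rewrite /terminated /=; apply/idP/eqP => [|e0]; last first.
  apply/existsPn => a; apply/existsPn => b.
  by rewrite -(mem_available d ps w) e0 inE.
move=> /existsPn h; apply/setP => e; rewrite [RHS]inE; apply/negbTE/negP => eA.
have /cards2P[a [b [_ eab]]] : #|e| == 2 by move: eA; rewrite inE => /and3P[].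
have /existsPn/(_ b) := h a.
by rewrite -(mem_available d ps w) /bins_of -eab eA.
Qed.

Lemma initial_graphs_rcons n (es : seq {set 'I_n}) e :
  initial_graphs (rcons es e) =
  rcons (initial_graphs es) (e |: [set f in es])%SET.
Proof.
rewrite /initial_graphs size_rcons -[_.+2]addn1 iotaD map_cat cats1 add0n.
congr rcons.
  apply/eq_in_map => s; rewrite mem_iota add0n ltnS => /andP[_ hs].
  by apply/setP => f; rewrite !inE -cats1 takel_cat.
rewrite -(size_rcons _ e) take_size; apply/setP => f.
by rewrite !inE mem_rcons inE.
Qed.

Lemma graphs_cons n p (ps : seq (bpair n)) :
  graphs (p :: ps) = if is_good ps p
    then rcons (graphs ps) (bins_of p |: graph_of ps)%SET else graphs ps.
Proof.
rewrite /graphs edges_cons; case: ifPn => // gp.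
rewrite rev_cons initial_graphs_rcons; congr (rcons _ (_ |: _)%SET).
by apply/setP => f; rewrite !inE mem_rev.
Qed.

Lemma last_graphs n (ps : seq (bpair n)) g : last g (graphs ps) = graph_of ps.
Proof.
elim: ps => [|p ps IH].
  by rewrite /graphs /initial_graphs /=; apply/setP => e; rewrite !inE.
rewrite graphs_cons; case: ifPn => [gp|bp]; last by rewrite graph_of_cons_bad.
by rewrite last_rcons graph_of_cons.
Qed.

Lemma size_graphs n (ps : seq (bpair n)) :
  size (graphs ps) = (size (edges ps)).+1.
Proof. by rewrite /graphs /initial_graphs size_map size_iota size_rev. Qed.

Lemma graphs_nil n : graphs [::] = [:: empty_graph n].
Proof.
by rewrite /graphs /initial_graphs /=; congr [:: _]; apply/setP => e; rewrite !inE.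
Qed.

Local Open Scope ring_scope.

(** * Two consecutive numbered balls *)

Lemma card_bins_of_fiber n (e : {set 'I_n}) : #|e| = 2 ->
  #|[pred p : bpair n | bins_of p == e]| = 2.
Proof.
move=> /eqP/cards2P[a [b [ab ->]]].
have ne : (a, b) != (b, a) by apply: contraNneq ab => -[->].
rewrite (@eq_card _ _ [set (a, b); (b, a)]%SET) ?cards2 ?ne // => -[x y].
rewrite !inE /bins_of /= !xpair_eqE; apply/eqP/orP => [/setP h|].
  have := h a; have := h b; have := h x; have := h y; rewrite !inE !eqxx ?orbT /=.
  move=> /esym/orP[]/eqP-> /esym/orP[]/eqP->; rewrite ?eqxx ?orbT ?andbT ?orbb; auto.
  - by rewrite eq_sym (negPf ab).
  - by move=> _; rewrite (negPf ab).
by case=> /andP[/eqP-> /eqP->] //; rewrite finset.setUC.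
Qed.

(** The uniformity at the heart of the theorem: the change that a pair of
    numbered balls makes to an observable [psi] of the graphs so far, summed over
    the possible bins, is twice the change made by a new edge, summed over the
    available edges.  Bad pairs contribute nothing, and each available edge is
    spanned by two ordered pairs. *)
Lemma sum_over_pairs (V : zmodType) n d (ps : seq (bpair n))
    (psi : seq (graph n) -> V) :
  \sum_(a | unsaturated d (BinState ps None) a)
    \sum_(b | unsaturated d (BinState ps None) b)
      (psi (graphs ((a, b) :: ps)) - psi (graphs ps)) =
  (\sum_(e in available d (graph_of ps))
     (psi (rcons (graphs ps) (e |: graph_of ps)%SET) - psi (graphs ps))) *+ 2.
Proof.
rewrite pair_big /=.
pose D e := psi (rcons (graphs ps) (e |: graph_of ps)%SET) - psi (graphs ps).
transitivity (\sum_(p : bpair n | bins_of p \in available d (graph_of ps))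
                D (bins_of p)).
  rewrite big_mkcond [RHS]big_mkcond; apply: eq_bigr => -[a b] _ /=.
  rewrite (mem_available d ps None) andbA graphs_cons.
  by case: (_ && _) => //=; case: ifP => // _; rewrite subrr.
rewrite (partition_big (@bins_of n) (mem (available d (graph_of ps)))) //=.
rewrite -sumrMnl; apply: eq_bigr => e eA.
rewrite (eq_bigl [pred p : bpair n | bins_of p == e]); last first.
  by move=> p /=; rewrite andb_idl // => /eqP->.
rewrite (eq_bigr (fun=> D e)); last by move=> p /eqP->.
rewrite sumr_const card_bins_of_fiber //.
by move: eA; rewrite inE => /and3P[/eqP].
Qed.

(** * The chain of bin states stopped at termination *)

Definition step n d (st : bin_state n) (b : 'I_n) : bin_state n :=
  if terminated d st then st else drop_ball d st b.

(** The transition operator of the stopped chain, acting on observables. *)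
Definition mean (R : realType) n d (F : bin_state n -> R)
    (st : bin_state n) : R :=
  n%:R^-1 * \sum_b F (step d st b).

Lemma mean_terminated (R : realType) n d (F : bin_state n -> R) st :
  (0 < n)%N -> terminated d st -> mean d F st = F st.
Proof.
move=> n0 te; rewrite /mean /step te sumr_const card_ord -[F st *+ _]mulr_natl mulKf //.
by rewrite pnatr_eq0 -lt0n.
Qed.

Lemma mean_running (R : realType) n d (F : bin_state n -> R) st :
  (0 < n)%N -> ~~ terminated d st ->
  mean d F st =
  F st + n%:R^-1 * \sum_(b | unsaturated d st b) (F (drop_ball d st b) - F st).
Proof.
move=> n0 nte; have nn0 : n%:R != 0 :> R by rewrite pnatr_eq0 -lt0n.
apply: (mulfI nn0); rewrite mulrDr !mulVKf //.
rewrite /step (negPf nte) [in RHS]big_mkcond /=.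
have -> : n%:R * F st = \sum_(b : 'I_n) F st.
  by rewrite sumr_const card_ord mulr_natl.
rewrite -big_split /=.
apply: eq_bigr => b _; rewrite {1}/drop_ball.
by case: ifPn => h; rewrite ?addr0 // /drop_ball h addrC subrK.
Qed.

(** * Observables of the graphs as observables of the state *)

(** While a ball waits, the observable is averaged over the bin of the next
    numbered ball.  With this choice, a waiting state contributes no drift
    ([mean_lift_waiting]), and the drift in the absence of a waiting ball is that
    of a whole pair ([mean_lift_None]).  At a terminated state no further average
    is taken, as the chain is stopped there. *)
Definition lift_to_state (R : realType) n d (psi : seq (graph n) -> R)
    (st : bin_state n) : R :=
  if waiting st is Some a then
    if terminated d st then psi (graphs (pairs st)) else
    #|unsaturated d st|%:R^-1 *
      \sum_(b | unsaturated d st b) psi (graphs ((a, b) :: pairs st))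
  else psi (graphs (pairs st)).

Lemma unsaturated_card_gt0 n d (st : bin_state n) : ~~ terminated d st ->
  (0 < #|unsaturated d st|)%N.
Proof.
by move=> /negbNE/existsP[a /existsP[b /and3P[ua _ _]]]; apply/card_gt0P; exists a.
Qed.

Lemma mean_lift_waiting (R : realType) n d (psi : seq (graph n) -> R) ps a :
  (0 < n)%N -> ~~ terminated d (BinState ps (Some a)) ->
  mean d (lift_to_state d psi) (BinState ps (Some a)) =
  lift_to_state d psi (BinState ps (Some a)).
Proof.
move=> n0 nte; rewrite mean_running //.
have u0 : #|unsaturated d (BinState ps (Some a))|%:R != 0 :> R.
  by rewrite pnatr_eq0 -lt0n unsaturated_card_gt0.
rewrite sumrB sumr_const.
rewrite [X in X - _](_ : _ = \sum_(b | unsaturated d (BinState ps (Some a)) b)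
   psi (graphs ((a, b) :: ps))); last first.
  by apply: eq_bigr => b ub; rewrite /drop_ball ub.
rewrite /lift_to_state /= (negPf nte).
by rewrite -[(_ * _) *+ _]mulr_natl mulVKf // subrr mulr0 addr0.
Qed.

Lemma mean_lift_None (R : realType) n d (psi : seq (graph n) -> R) ps :
  (0 < n)%N -> ~~ terminated d (BinState ps None) ->
  mean d (lift_to_state d psi) (BinState ps None) = psi (graphs ps) +
  2 / (n%:R * #|unsaturated d (BinState ps None)|%:R) *
  \sum_(e in available d (graph_of ps))
     (psi (rcons (graphs ps) (e |: graph_of ps)%SET) - psi (graphs ps)).
Proof.
move=> n0 nte; rewrite mean_running //.
set u := #|_|.
have u0 : u%:R != 0 :> R by rewrite pnatr_eq0 -lt0n unsaturated_card_gt0.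
rewrite {1}/lift_to_state /=; congr (_ + _).
rewrite (eq_bigr (fun a => u%:R^-1 *
  \sum_(b | unsaturated d (BinState ps None) b)
    (psi (graphs ((a, b) :: ps)) - psi (graphs ps)))); last first.
  move=> a ua; rewrite /drop_ball ua /lift_to_state /=.
  rewrite (_ : terminated _ _ = false); last exact: negPf nte.
  by rewrite sumrB sumr_const mulrBr -[psi (graphs ps) *+ _]mulr_natl mulKf.
rewrite -mulr_sumr sum_over_pairs -[(\sum_(e in _) _) *+ 2]mulr_natl invfM; ring.
Qed.

(** * The law of the graph process *)

(** A proportion of the available edges rather than a case distinction: the value
    is [0] both when [g'] is not a successor of [g] and when no edge is available,
    since the inverse of [0] is [0]. *)
Definition edge_prob (R : realType) n d (g g' : graph n) : R :=
  #|[set e in available d g | (e |: g)%SET == g']%SET|%:R / #|available d g|%:R.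

(** The probability that, once at [g], the graph process goes on with exactly the
    graphs in [t] and then stops. *)
Fixpoint path_prob (R : realType) n d (g : graph n) (t : seq (graph n)) : R :=
  if t is g' :: t' then edge_prob R d g g' * path_prob R d g' t'
  else (available d g == finset.set0)%:R.

Lemma edge_prob_ge0 (R : realType) n d (g g' : graph n) : 0 <= edge_prob R d g g'.
Proof. by rewrite divr_ge0 // ler0n. Qed.

Lemma path_prob_ge0 (R : realType) n d (g : graph n) t : 0 <= path_prob R d g t.
Proof.
by elim: t g => [|g' t IH] g /=; rewrite ?ler0n // mulr_ge0 ?edge_prob_ge0.
Qed.

(** The conditional probability that the whole run of the graph process is [t],
    given that it starts with [s]. *)
Definition completion_prob (R : realType) n d (t s : seq (graph n)) : R :=
  if prefix s t then path_prob R d (last finset.set0 s) (drop (size s) t) else 0.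

Lemma completion_prob_ge0 (R : realType) n d (t s : seq (graph n)) :
  0 <= completion_prob R d t s.
Proof. by rewrite /completion_prob; case: ifP; rewrite ?path_prob_ge0. Qed.

Lemma completion_prob_refl (R : realType) n d (s : seq (graph n)) :
  completion_prob R d s s = (available d (last finset.set0 s) == finset.set0)%:R.
Proof. by rewrite /completion_prob prefix_refl drop_size. Qed.

Lemma prefix_rcons_cat (T : eqType) (s t : seq T) x y :
  prefix (rcons s x) (s ++ y :: t) = (x == y).
Proof. by rewrite -cats1 prefix_catr // eqxx prefix_cons prefix0s andbT. Qed.

(** Among the one-edge extensions of a proper initial segment [s] of [t], only
    those that agree with [t] keep a nonzero value, and the transition probability
    in [path_prob] is exactly their proportion. *)
Lemma completion_prob_harmonic (R : realType) n d (t s : seq (graph n)) g :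
  available d g != finset.set0 -> last finset.set0 s = g ->
  \sum_(e in available d g)
    (completion_prob R d t (rcons s (e |: g)%SET) - completion_prob R d t s) = 0.
Proof.
move=> A0 sg; have [/prefixP[r ->{t}]|nst] := boolP (prefix s t); last first.
  rewrite big1 // => e _; rewrite /completion_prob (negPf nst) subr0.
  by case: ifP => // /(prefix_trans (prefix_rcons s _)) st; rewrite st in nst.
have a0 : #|available d g|%:R != 0 :> R by rewrite pnatr_eq0 cards_eq0.
case: r => [|g' r].
  rewrite cats0 completion_prob_refl sg (negPf A0) big1 // => e _.
  rewrite /completion_prob; case: ifP; rewrite ?subr0 // => /size_prefix.
  by rewrite size_rcons ltnn.
rewrite sumrB sumr_const {2}/completion_prob prefix_prefix sg.
rewrite drop_size_cat //= -[_ *+ #|_|]mulr_natl mulrA /edge_prob.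
rewrite mulrCA mulfV // mulr1.
apply/eqP; rewrite subr_eq0 mulr_natl -sumr_const; apply/eqP.
rewrite [RHS](eq_bigl
  (fun e => (e \in available d g) && ((e |: g)%SET == g'))).
  rewrite big_mkcondr; apply: eq_bigr => e _.
  rewrite /completion_prob prefix_rcons_cat last_rcons -cat_rcons size_rcons.
  by case: eqP => // ->; rewrite drop_size_cat ?size_rcons.
by move=> e; rewrite inE.
Qed.

(** * Iterated transitions *)

Lemma le_mean (R : realType) n d (F F' : bin_state n -> R) :
  (forall st, F st <= F' st) -> forall st, mean d F st <= mean d F' st.
Proof.
by move=> le_F st; rewrite ler_wpM2l ?invr_ge0 ?ler0n // ler_sum.
Qed.

Lemma mean_cst (R : realType) n d (c : R) (st : bin_state n) : (0 < n)%N ->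
  mean d (fun=> c) st = c.
Proof.
move=> n0; rewrite /mean sumr_const card_ord -[c *+ _]mulr_natl mulKf //.
by rewrite pnatr_eq0 -lt0n.
Qed.

Lemma meanD (R : realType) n d (F F' : bin_state n -> R) st :
  mean d (fun st => F st + F' st) st = mean d F st + mean d F' st.
Proof. by rewrite /mean big_split mulrDr. Qed.

Lemma meanZ (R : realType) n d (c : R) (F : bin_state n -> R) st :
  mean d (fun st => c * F st) st = c * mean d F st.
Proof. by rewrite /mean -mulr_sumr mulrCA. Qed.

Lemma le_iter_mean (R : realType) n d (F F' : bin_state n -> R) t :
  (forall st, F st <= F' st) ->
  forall st, iter t (mean d) F st <= iter t (mean d) F' st.
Proof. by move=> le_F; elim: t => [//|t IH] st /=; apply: le_mean. Qed.

Lemma iter_meanD (R : realType) n d (F F' : bin_state n -> R) t st :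
  iter t (mean d) (fun st => F st + F' st) st =
  iter t (mean d) F st + iter t (mean d) F' st.
Proof.
elim: t st => [//|t IH] st; rewrite !iterS -meanD.
by congr mean; apply/funext => st'; exact: IH.
Qed.

Lemma iter_meanZ (R : realType) n d (c : R) (F : bin_state n -> R) t st :
  iter t (mean d) (fun st => c * F st) st = c * iter t (mean d) F st.
Proof.
elim: t st => [//|t IH] st; rewrite !iterS -meanZ.
by congr mean; apply/funext => st'; exact: IH.
Qed.

Lemma iter_mean_cst (R : realType) n d (c : R) t (st : bin_state n) : (0 < n)%N ->
  iter t (mean d) (fun=> c) st = c.
Proof.
move=> n0; elim: t st => [//|t IH] st; rewrite iterS -[RHS](mean_cst d c st n0).
by congr mean; apply/funext => st'; exact: IH.
Qed.

(** Nonterminated states have an available edge, so that the drift computed in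
    [mean_lift_None] vanishes by harmonicity for the graph process. *)
Lemma iter_mean_completion_prob (R : realType) n d s t (st : bin_state n) :
  (0 < n)%N ->
  iter t (mean d) (lift_to_state d (completion_prob R d s)) st =
  lift_to_state d (completion_prob R d s) st.
Proof.
move=> n0; elim: t st => [//|t IH] st; rewrite iterS.
transitivity (mean d (lift_to_state d (completion_prob R d s)) st).
  by congr mean; apply/funext => st'; exact: IH.
have [te|nte] := boolP (terminated d st); first by rewrite mean_terminated.
case: st nte => ps [a|] nte; first by rewrite mean_lift_waiting.
rewrite mean_lift_None // completion_prob_harmonic ?mulr0 ?addr0 ?last_graphs //.
by move: nte; rewrite terminatedE.
Qed.

(** * Termination *)

Definition running (R : realType) n d (st : bin_state n) : R :=
  (~~ terminated d st)%:R.

Lemma running_decreasing (R : realType) n d t (st : bin_state n) : (0 < n)%N ->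
  iter t.+1 (mean d) (running R d) st <= iter t (mean d) (running R d) st.
Proof.
move=> n0; rewrite iterSr; apply: le_iter_mean => {}st.
have [te|nte] := boolP (terminated d st); first by rewrite mean_terminated.
rewrite {2}/running nte -[leRHS](mean_cst d 1 st n0); apply: le_mean => st'.
by rewrite lern1 leq_b1.
Qed.

(** The number of edges alone does not drift upwards while a ball waits, since
    [lift_to_state] makes it a martingale there.  The penalty for a waiting ball is
    gained back with probability at least [n ^-1] at the next ball, and it is small
    enough not to cancel the drift [2 / n ^+ 2] in the absence of a waiting ball. *)
Definition potential (R : realType) n d (st : bin_state n) : R :=
  lift_to_state d (fun gs => (size gs)%:R) st +
  - n%:R^-1 ^+ 2 * (waiting st)%:R.

Lemma potential_bounds (R : realType) n d (st : bin_state n) : (0 < n)%N ->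
  -1 <= potential R d st <= (#|{set 'I_n}|.+1)%:R.
Proof.
move=> n0; pose K : R := (#|{set 'I_n}|.+1)%:R.
have gK (ps : seq (bpair n)) : 0 <= ((size (graphs ps))%:R : R) <= K.
  by rewrite ler0n ler_nat size_graphs ltnS edges_bound.
have /andP[l0 lK] : 0 <= lift_to_state d (fun gs => (size gs)%:R : R) st <= K.
  case: st => ps [a|]; rewrite /lift_to_state [waiting _]/= [pairs _]/=; last exact: gK.
  have [_|nte] := boolP (terminated _ _); first exact: gK.
  have u0 := unsaturated_card_gt0 nte.
  rewrite mulr_ge0 ?invr_ge0 ?ler0n ?sumr_ge0 //.
  rewrite ler_pdivrMl ?ltr0n // mulr_natl -sumr_const ler_sum // => b _.
  by have /andP[] := gK ((a, b) :: ps).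
have n1 : 0 <= (n%:R^-1 : R) <= 1.
  by rewrite invr_ge0 ler0n invf_le1 ?ltr0n // ler1n.
rewrite /potential; case: (waiting st) => [a|] /=; rewrite ?mulr1 ?mulr0; nra.
Qed.

Lemma potential_drift (R : realType) n d (st : bin_state n) : (0 < n)%N ->
  potential R d st + n%:R^-1 ^+ 3 * running R d st <= mean d (potential R d) st.
Proof.
move=> n0; have [te|nte] := boolP (terminated d st).
  by rewrite mean_terminated // /running te mulr0 addr0.
rewrite /running nte mulr1 meanD meanZ.
have u0 := unsaturated_card_gt0 nte.
have un : (#|unsaturated d st| <= n)%N by rewrite -[leqRHS]card_ord max_card.
have x0 : 0 < n%:R^-1 :> R by rewrite invr_gt0 ltr0n.
have nx : n%:R * n%:R^-1 = 1 :> R by rewrite mulfV // pnatr_eq0 -lt0n.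
rewrite (mean_running (fun st => (waiting st)%:R)) //.
case: st nte u0 un => ps [a|] nte u0 un.
  rewrite mean_lift_waiting // /potential /= mulr1.
  rewrite (eq_bigr (fun=> -1)); last by move=> b ub; rewrite /drop_ball ub sub0r.
  rewrite sumr_const.
  have : 1 <= #|unsaturated d (BinState ps (Some a))|%:R :> R by rewrite ler1n.
  rewrite mulNrn; set u := _%:R; set x := n%:R^-1 in x0 nx *; move=> u1.
  have : x ^+ 3 <= x ^+ 3 * u by rewrite ler_peMr // exprn_ge0 // ltW.
  nra.
rewrite mean_lift_None // /potential {1}/lift_to_state.
rewrite [waiting _]/= [pairs _]/= mulr0 addr0 add0r.
rewrite (eq_bigr (fun=> 1)); last first.
  by move=> e _; rewrite size_rcons -natr1 addrAC subrr add0r.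
rewrite sumr_const (eq_bigr (fun=> 1)); last first.
  by move=> b ub; rewrite /drop_ball ub subr0.
rewrite sumr_const.
rewrite -[X in _ * (_ * X)]/(#|unsaturated d (BinState ps None)|%:R) invfM.
have m1 : 1 <= #|available d (graph_of ps)|%:R :> R.
  rewrite ler1n card_gt0.
  by rewrite -[graph_of ps]/(graph_of (pairs (BinState ps None))) -terminatedE.
have yx : n%:R^-1 <= #|unsaturated d (BinState ps None)|%:R^-1 :> R.
  by rewrite lef_pV2 ?posrE ?ltr0n // ler_nat.
have xu : n%:R^-1 * #|unsaturated d (BinState ps None)|%:R <= 1 :> R.
  by rewrite -[leRHS]nx [leRHS]mulrC ler_wpM2l ?ler_nat ?(ltW x0) //.
have x1 : n%:R^-1 <= 1 :> R by rewrite invf_le1 ?ltr0n // ler1n.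
set u : R := #|unsaturated d _|%:R in yx xu *.
set m : R := #|available d _|%:R in m1 *.
move: (n%:R^-1) (u^-1) x0 x1 yx xu => x y x0 x1 yx xu.
have h1 : x ^+ 3 <= x ^+ 2 by rewrite exprS ler_piMl // sqr_ge0.
have h2 : x ^+ 2 * (x * u) <= x ^+ 2 by rewrite ler_piMr // sqr_ge0.
have h3 : x ^+ 2 <= x * y * m.
  rewrite expr2 -[x * x]mulr1 ler_pM // ?mulr_ge0 ?ler_wpM2l // ltW //.
by rewrite -[2 * _ * m]mulrA mulNr -addrA lerD2l; lra.
Qed.

(** The total drift up to time [t] is at least [n ^- 3] times the sum of the
    probabilities of running at the earlier times, which decrease; it is bounded
    because the potential is. *)
Lemma running_bound (R : realType) n d t (st : bin_state n) : (0 < n)%N ->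
  t%:R * iter t (mean d) (running R d) st <=
  n%:R ^+ 3 * (#|{set 'I_n}|.+2)%:R.
Proof.
move=> n0; have n3 : 0 < n%:R ^+ 3 :> R by rewrite exprn_gt0 // ltr0n.
rewrite -ler_pdivrMl //; set c := _^-1.
have H : potential R d st + c * (t%:R * iter t (mean d) (running R d) st) <=
         iter t (mean d) (potential R d) st.
  elim: t => [|t IH]; first by rewrite mul0r mulr0 addr0.
  apply: le_trans (_ : iter t (mean d)
    (fun st => potential R d st + c * running R d st) st <= _).
    rewrite iter_meanD iter_meanZ.
    apply: le_trans (lerD IH (lexx _)).
    rewrite -[leRHS]addrA lerD2l -mulrDr ler_wpM2l ?invr_ge0 ?(ltW n3) //.
    rewrite -[X in _ <= _ + X]mul1r -mulrDl natr1 ler_wpM2l ?ler0n //.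
    exact: running_decreasing.
  rewrite iterSr; apply: le_iter_mean => st'.
  by rewrite /c -exprVn potential_drift.
have /andP[lb _] := potential_bounds R d st n0.
have ub : iter t (mean d) (potential R d) st <= (#|{set 'I_n}|.+1)%:R.
  rewrite -[leRHS](iter_mean_cst d _ t st n0); apply: le_iter_mean => st'.
  by have /andP[] := potential_bounds R d st' n0.
by rewrite -natr1; lra.
Qed.

Local Open Scope classical_set_scope.
Local Open Scope ring_scope.
Local Open Scope ereal_scope.

(** * Comparing discrete laws *)

(** Both total masses are [1], so a domination of one law by the other on every
    set, applied to a set and to its complement, is an equality. *)
Lemma discrete_le_same_distribution (R : realType)
    (d1 d2 : measure_display) (T1 : measurableType d1) (T2 : measurableType d2)
    (P1 : probability T1 R) (P2 : probability T2 R)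
    (U : countType) (Y1 : T1 -> U) (Y2 : T2 -> U) :
  discrete_RV Y1 -> discrete_RV Y2 ->
  (forall u, P1 (Y1 @^-1` [set u]) <= P2 (Y2 @^-1` [set u])) ->
  same_distribution P1 P2 Y1 Y2.
Proof.
move=> mY1 mY2 le1; split=> // A.
have slices d (T : measurableType d) (P : probability T R) (Y : T -> U)
    (mY : discrete_RV Y) (B : set U) : P (Y @^-1` B) =
    \sum_(0 <= k <oo | k \in [set: nat])
       P (Y @^-1` (B `&` [set u | choice.pickle u = k])).
  rewrite -measure_bigcup.
  - congr (P _); apply/seteqP; split=> [w Bw|w [k _ []] //].
    by exists (choice.pickle (Y w)).
  - by move=> k _; exact: mY.
  - by move=> i j _ _ [w [[_ /= <-] [_ /= <-]]].
have leA B : P1 (Y1 @^-1` B) <= P2 (Y2 @^-1` B).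
  rewrite (slices _ _ _ _ mY1) (slices _ _ _ _ mY2).
  apply: lee_nneseries => k _ //.
  have [[u [Bu uk]]|no] := pselect (exists u, B u /\ choice.pickle u = k).
    rewrite (_ : _ `&` _ = [set u]) //; apply/seteqP; split=> [v [_ /= vk]|v ->//].
    by apply: (pcan_inj choice.pickleK); rewrite uk.
  rewrite (_ : _ `&` _ = set0) ?preimage_set0 ?measure0 //.
  by apply/seteqP; split=> // v [Bv vk]; apply: no; exists v.
apply/eqP; rewrite eq_le leA /=.
have : P1 (~` (Y1 @^-1` A)) <= P2 (~` (Y2 @^-1` A)) := leA (~` A).
rewrite (probability_setC P1 (mY1 A)) (probability_setC P2 (mY2 A)).
rewrite -(fineK (fin_num_measure P1 _ (mY1 A))).
rewrite -(fineK (fin_num_measure P2 _ (mY2 A))).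
by rewrite -!EFinB !lee_fin lerD2l lerN2.
Qed.

(** * A lower bound for graph processes *)

Lemma graph_process_ge (R : realType)
    (disp : measure_display) (T : measurableType disp) (P : probability T R)
    (n d : nat) (G : T -> seq (graph n)) : graph_process P d G ->
  forall t h g, P [set w | prefix (rcons h g) (G w)] * (path_prob R d g t)%:E <=
    P (G @^-1` [set rcons h g ++ t]).
Proof.
move=> [mG _ stepG]; elim=> [|g' t IH] h g /=.
  rewrite cats0; case: eqP => [A0|_]; last by rewrite mule0.
  by rewrite mule1; have [/(_ A0) <-] := stepG h g.
rewrite /edge_prob; set E := finset _.
have [->|/set0Pn[e]] := eqVneq E finset.set0.
  by rewrite cards0 !mul0r mule0.
rewrite inE => /andP[eA /eqP eg'].
have -> : E = [set e]%SET.
  (* Adding distinct new edges to [g] gives distinct graphs. *)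
  apply/setP => f; rewrite [LHS]inE [RHS]inE; apply/andP/eqP => [[fA /eqP fg]|->]; last first.
    by rewrite eg' eqxx.
  move: eA fA; rewrite !inE => /and3P[_ eg _] /and3P[_ fng _].
  have : e \in (f |: g)%SET by rewrite fg -eg' setU11.
  by rewrite !inE (negPf eg) orbF => /eqP.
rewrite cards1 mul1r EFinM muleA.
have [_ /(_ e eA) <-] := stepG h g.
by rewrite -cat_rcons -eg'; exact: IH.
Qed.

(** * The stopped chain along a sequence of balls *)

Definition run n d (s : seq 'I_n) : bin_state n :=
  foldl (step d) (BinState [::] None) s.

Lemma run_rcons n d (s : seq 'I_n) b : run d (rcons s b) = step d (run d s) b.
Proof. exact: foldl_rcons. Qed.

(** [find] gives the first terminated time before [t], and [t] itself if there is
    none: the stopped chain is at the minimum of [t] and the termination time. *)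
Lemma run_bin_process n d (balls : nat -> 'I_n) t :
  run d (mkseq balls t) = bin_process d balls
    (find (fun i => terminated d (bin_process d balls i)) (iota 0 t)).
Proof.
set stop := fun i => _; elim: t => [//|t IH].
rewrite mkseqS run_rcons IH -addn1 iotaD add0n find_cat size_iota /= /step.
have [ht|/hasNfind ->] := boolP (has stop (iota 0 t)).
  have /= := nth_find 0%N ht; rewrite nth_iota ?add0n; last first.
    by rewrite -[ltnRHS](size_iota 0) -has_find.
  by rewrite {1}/stop => ->.
rewrite size_iota; case: ifPn => [st|nst]; rewrite /stop ?st ?(negPf nst).
  by rewrite addn0.
by rewrite addn1.
Qed.

Lemma bin_graph_process_run n d (balls : nat -> 'I_n) t :
  terminated d (run d (mkseq balls t)) ->
  bin_graph_process d balls = graphs (pairs (run d (mkseq balls t))).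
Proof.
rewrite run_bin_process; set i := find _ _ => ti.
rewrite /bin_graph_process; case: pselect => [ex|]; last by case; exists i.
congr (bin_graphs (bin_process _ _ _)); case: ex_minnP => m tm min_m.
apply/eqP; rewrite eqn_leq min_m //= leqNgt; apply/negP => mi.
have := before_find 0%N mi; rewrite nth_iota ?add0n ?tm //.
by apply: leq_trans mi _; rewrite -[leqRHS](size_iota 0) find_size.
Qed.

Lemma bin_graph_process_running n d (balls : nat -> 'I_n) :
  (forall t, ~~ terminated d (run d (mkseq balls t))) ->
  bin_graph_process d balls = [::].
Proof.
move=> nt; rewrite /bin_graph_process; case: pselect => // -[t tt].
have := nt t.+1; rewrite run_bin_process.
set stop := fun i => _; have ht : has stop (iota 0 t.+1).
  by apply/hasP; exists t; rewrite // mem_iota add0n ltnS leqnn.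
have lt_t : (find stop (iota 0 t.+1) < t.+1)%N.
  by have := ht; rewrite has_find size_iota.
by have := nth_find 0%N ht; rewrite nth_iota // add0n {1}/stop => ->.
Qed.

(** * The law of the bin process *)

Lemma split_by_value n (T : Type) (Z : T -> 'I_n) (A : set T) :
  A = \big[setU/set0]_(b < n) (A `&` Z @^-1` [set b]).
Proof.
rewrite -bigcup_seq; apply/seteqP; split=> [w Aw|w [b _ []] //].
by exists (Z w) => //=; rewrite mem_index_enum.
Qed.

Section Balls.
Variables (R : realType) (disp : measure_display) (T : measurableType disp).
Variables (P : probability T R) (n d : nat) (X : nat -> T -> 'I_n).
Hypotheses (n0 : (0 < n)%N) (unifX : uniform_balls P X).

Lemma measurable_mkseq t (D : set (seq 'I_n)) :
  measurable [set w | D (mkseq (X^~ w) t)].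
Proof.
have [mX _ _] := unifX.
elim: t D => [|t IH] D.
  have [D0|nD0] := pselect (D [::]).
    by rewrite (_ : [set w | _] = setT) //; apply/seteqP; split.
  by rewrite (_ : [set w | _] = set0) //; apply/seteqP; split.
rewrite (split_by_value (X t) [set w | _]).
apply: bigsetU_measurable => b _.
rewrite (_ : _ `&` _ =
  [set w | D (rcons (mkseq (X^~ w) t) b)] `&` X t @^-1` [set b]).
  apply: measurableI; last exact: mX.
  exact: (IH [set s | D (rcons s b)]).
by apply/seteqP; split=> w /= []; rewrite mkseqS => + Xb; rewrite Xb.
Qed.

Lemma probability_mkseq (s : seq 'I_n) :
  P [set w | mkseq (X^~ w) (size s) = s] = (n%:R^-1 ^+ size s)%:E.
Proof.
have [_ pX iX] := unifX.
pose b0 := Ordinal n0.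
have := iX (iota 0 (size s)) (fun i => [set nth b0 s i]) (iota_uniq _ _).
rewrite (eq_bigr (fun=> n%:R^-1%:E)); last by move=> i _; rewrite pX.
rewrite big_const_seq count_predT size_iota.
rewrite (_ : iter _ _ _ = (n%:R^-1 ^+ size s)%:E); last first.
  by elim: (size s) => [//|k IH] /=; rewrite IH -EFinM -exprS.
move=> <-; congr (P _); apply/seteqP; split=> w /=.
  move=> ws i /=; rewrite mem_iota => /andP[_ hi].
  by rewrite -ws nth_mkseq.
move=> ws; apply: (@eq_from_nth _ b0); rewrite size_mkseq // => i hi.
by rewrite nth_mkseq // (ws i) //= mem_iota.
Qed.

(** The Markov property, proved by conditioning on the first balls: once these are
    known, the law of the state [t] balls later is given by [t] transitions. *)
Lemma probability_run (D : pred (bin_state n)) t (s : seq 'I_n) :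
  P [set w | mkseq (X^~ w) (size s) = s /\
             D (run d (mkseq (X^~ w) (size s + t)))] =
  (n%:R^-1 ^+ size s * iter t (mean d) (fun st => (D st)%:R) (run d s))%:E.
Proof.
elim: t s => [|t IH] s.
  rewrite addn0 /=; have [Ds|nDs] := boolP (D (run d s)).
    rewrite mulr1 -probability_mkseq; congr (P _).
    by apply/seteqP; split=> w /= => [[]//|ws]; rewrite ws.
  rewrite mulr0 -[RHS](measure0 P); congr (P _).
  by apply/seteqP; split=> w //= [ws]; rewrite ws (negPf nDs).
rewrite (split_by_value (X (size s)) [set w | _]) measure_bigsetU_ord; first last.
- by move=> a b _ _ [w [[_ /= <-] [_ /= <-]]].
- move=> b; have [mX _ _] := unifX; apply: measurableI; last exact: mX.
  apply: (@measurableI _ _ [set w | mkseq (X^~ w) (size s) = s]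
    [set w | D (run d (mkseq (X^~ w) (size s + t.+1)))]).
    exact: (measurable_mkseq _ [set s]).
  exact: (measurable_mkseq _ [set r | D (run d r)]).
rewrite iterS /mean mulrA -exprSr mulr_sumr -sumEFin.
apply: eq_bigr => b _.
have := IH (rcons s b); rewrite run_rcons size_rcons => <-; congr (P _).
rewrite addnS addSn; apply/seteqP; split=> w /=; rewrite (mkseqS _ (size s)).
  by move=> [[-> DX] ->].
by move=> [/rcons_inj[-> ->] DX].
Qed.

Lemma probability_run0 (D : pred (bin_state n)) t :
  P [set w | D (run d (mkseq (X^~ w) t))] =
  (iter t (mean d) (fun st => (D st)%:R) (BinState [::] None))%:E.
Proof.
have := probability_run D t [::]; rewrite expr0 mul1r => <-; congr (P _).
by apply/seteqP; split=> w //= [].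
Qed.

Lemma measurable_bin_graph_process :
  discrete_RV (fun w => bin_graph_process d (X^~ w)).
Proof.
move=> A; pose N t := [set w | ~~ terminated d (run d (mkseq (X^~ w) t))].
pose S t := [set w | terminated d (run d (mkseq (X^~ w) t)) /\
                     A (graphs (pairs (run d (mkseq (X^~ w) t))))].
rewrite (_ : _ @^-1` A =
  (\bigcup_t S t) `|` ([set _ | A [::]] `&` \bigcap_t N t)).
  apply: measurableU.
    apply: bigcup_measurable => t _.
    exact: (measurable_mkseq _
      [set s | terminated d (run d s) /\ A (graphs (pairs (run d s)))]).
  apply: measurableI; last first.
    apply: bigcapT_measurable => t.
    exact: (measurable_mkseq _ [set s | ~~ terminated d (run d s)]).
  exact: (measurable_mkseq 0 [set _ | A [::]]).
apply/seteqP; split=> w /=.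
  move=> Aw.
  have [[t tt]|nt] :=
    pselect (exists t, terminated d (run d (mkseq (X^~ w) t))).
    by left; exists t => //; split=> //; rewrite -bin_graph_process_run.
  have {}nt t : ~~ terminated d (run d (mkseq (X^~ w) t)).
    by apply/negP => tt; apply: nt; exists t.
  by right; split=> [|t _]; [rewrite -(bin_graph_process_running nt) | exact: nt].
case=> [[t _ [tt At]]|[A0 nt]]; first by rewrite (bin_graph_process_run tt).
by rewrite bin_graph_process_running // => t; exact: nt.
Qed.

(** For each [t], the event that the run is [s] forces the state after [t] balls
    to be running or to have produced [s]; the indicator of this is at most the
    sum of [running] and of a harmonic function. *)
Lemma bin_graph_process_le (s : seq (graph n)) :
  P ((fun w => bin_graph_process d (X^~ w)) @^-1` [set s]) <=
  (completion_prob R d s [:: empty_graph n])%:E.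
Proof.
have mY := measurable_bin_graph_process [set s].
set x := P _; have fx : x \is a fin_num by exact: fin_num_measure.
pose K : R := (n%:R ^+ 3 * (#|{set 'I_n}|.+2)%:R)%R.
pose st0 : bin_state n := BinState [::] None.
have bound t : (fine x <= completion_prob R d s [:: empty_graph n] +
    iter t (mean d) (running R d) st0)%R.
  (* On a nonterminating run, [s] may be [[::]]; [D] holds then as well. *)
  pose D (st : bin_state n) := ~~ terminated d st || (graphs (pairs st) == s).
  rewrite -lee_fin fineK //.
  apply: (@le_trans _ _ (P [set w | D (run d (mkseq (X^~ w) t))])).
    apply: le_measure; rewrite ?inE //.
      exact: (measurable_mkseq _ [set s | D (run d s)]).
    move=> w /= Yw; rewrite /D; case: (boolP (terminated _ _)) => //= te.
    by rewrite -bin_graph_process_run // Yw.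
  rewrite probability_run0 lee_fin -graphs_nil.
  rewrite -[completion_prob _ _ _ _]/(lift_to_state d (completion_prob R d s) st0).
  rewrite -(iter_mean_completion_prob R d s t st0 n0) -iter_meanD.
  apply: le_iter_mean => st; rewrite /D /running.
  have c0 := completion_prob_ge0 R d s.
  have [te|nte] /= := boolP (terminated d st).
    set gs := graphs _.
    have -> : lift_to_state d (completion_prob R d s) st =
              completion_prob R d s gs.
      by rewrite /lift_to_state te; case: waiting.
    rewrite addr0.
    have [<-|_] := eqVneq gs s; last exact: c0.
    by rewrite completion_prob_refl last_graphs -terminatedE te.
  rewrite lerDr /lift_to_state; case: waiting => [a|//].
  by rewrite (negPf nte) mulr_ge0 ?invr_ge0 ?ler0n ?sumr_ge0.
rewrite -(fineK fx) lee_fin; apply/ler_addgt0Pr => e e0.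
(* The bound [K / t] of [running_bound] is at most [e] for this [t]. *)
pose t := (Num.truncn (K / e)%R).+1.
apply: le_trans (bound t) _; rewrite lerD2l.
have t0 : (0 < t%:R :> R)%R by rewrite ltr0n.
rewrite -(ler_pM2l t0); apply: le_trans (running_bound R d t st0 n0) _.
by rewrite -ler_pdivrMr // ltW // truncnS_gt.
Qed.

End Balls.

Theorem lemma1p8 (R : realType) (d n : nat) (d_gt0 : (0 < d)%N) (n_gt0 : (0 < n)%N)
    (d1 : measure_display) (T1 : measurableType d1) (P1 : probability T1 R)
    (X : nat -> T1 -> 'I_n)
    (d2 : measure_display) (T2 : measurableType d2) (P2 : probability T2 R)
    (G : T2 -> seq (graph n)) :
  uniform_balls P1 X ->
  graph_process P2 d G ->
  same_distribution P1 P2 (fun w => bin_graph_process d (fun i => X i w)) G.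
Proof.
move=> unifX procG; have [mG startG _] := procG.
apply: discrete_le_same_distribution => // [|s].
  exact: (measurable_bin_graph_process d unifX).
apply: le_trans (bin_graph_process_le d n_gt0 unifX s) _.
rewrite /completion_prob; case: ifP => [/prefixP[t ->]|_]; last exact: measure_ge0.
rewrite drop_size_cat //=.
have := graph_process_ge procG t [::] (empty_graph n).
by rewrite startG mul1e.
Qed.
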